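(* Let $n \ge 3$. Consider $n$-dimensional simplices in Euclidean space $\mathbb{E}^n$ with vertices labeled $1, \dots, n+1$, and let $l_{ij}$ ($1 \le i < j \le n+1$) denote the length of the edge joining vertices $i$ and $j$. Let $U \subset \mathbb{R}^{n(n+1)/2}$ be the (nonempty, open) set of edge-length vectors $(l_{ij})_{i<j}$ realized by nondegenerate $n$-simplices. For each $(n-1)$-element subset $S \subset \{1,\dots,n+1\}$, let $V_S : U \to \mathbb{R}$ be the function assigning to an edge-length vector the $(n-2)$-dimensional volume of the $(n-2)$-dimensional face of the simplex spanned by the vertices in $S$ (this is well defined since a simplex is determined up to congruence by its edge lengths). Then the $\binom{n+1}{n-1} = n(n+1)/2$ functions $V_S$ are algebraically independent over $\mathbb{C}$: there is no nonzero polynomial $P$ with complex coefficients in $n(n+1)/2$ variables such that $P\big((V_S)_S\big)$ vanishes identically on $U$.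
   Context: An $n$-simplex in $\mathbb{E}^n$ is determined up to congruence by its $n(n+1)/2$ edge lengths; each $(n-2)$-dimensional face corresponds to a choice of $n-1$ of the $n+1$ vertices. *)

(* Defs.v *)
From HB Require Import structures.
From mathcomp Require Import all_boot all_order all_algebra.
From mathcomp Require Import reals.
From mathcomp Require Import complex.
From mathcomp Require Import mpoly.

Set Implicit Arguments.
Unset Strict Implicit.
Unset Printing Implicit Defensive.

Import Order.TTheory GRing.Theory Num.Theory.
Local Open Scope ring_scope.

(* Conventions: n >= 3 is the dimension; vertices are indexed by 'I_n.+1
   (vertex k of the paper is the ordinal k-1); points of E^n are row vectors
   'rV[R]_n over a real field R : realType (the real numbers). *)

Definition nondegenerate_simplex (R : realType) (n : nat) (p : 'I_n.+1 -> 'rV[R]_n) : Prop :=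
  \det (\matrix_(i < n) (p (lift ord0 i) - p ord0)) != 0.

(* k-dimensional volume of the simplex with vertices q0 :: qs (k = size qs) in
   R^n: sqrt(det of the Gram matrix of the edge vectors qi - q0) / k!. *)
Definition simplex_volume (R : realType) (n : nat) (q0 : 'rV[R]_n)
    (qs : seq 'rV[R]_n) : R :=
  let M := \matrix_(i < size qs) (nth 0 qs i - q0) in
  Num.sqrt (\det (M *m M^T)) / (size qs)`!%:R.

Definition face_volume (R : realType) (n : nat) (p : 'I_n.+1 -> 'rV[R]_n)
    (S : {set 'I_n.+1}) : R :=
  let s := [seq p i | i <- enum S] in
  simplex_volume (head 0 s) (behead s).

Definition face_index (n : nat) : finType :=
  {S : {set 'I_n.+1} | #|S| == n.-1}.

Definition face_volumes (R : realType) (n : nat) (p : 'I_n.+1 -> 'rV[R]_n) :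
    'I_#|{: face_index n}| -> R[i] :=
  fun k => (face_volume p (val (enum_val k)))%:C%C.

(* Main.v *)
(* Work at the regular simplex.  Along a line of vertex positions p + t q, each
   codimension-2 volume has the form V_S(t) = V_0 + t (c * sum of h over the edges in S) + O(t^2),
   where h is the first-order variation of the squared edge lengths and c <> 0 does not
   depend on S.  Every h is realized by some q, and h |-> (sum of h over the edges in S)_S is
   onto: indexing the faces by the complementary pairs of vertices, it is the adjacency operator
   of the Kneser graph K(n+1, 2), which has an explicit inverse.  If P(V) = 0 with P <> 0, the
   lowest homogeneous part of Y |-> P(V_0 + Y) would then vanish on all real vectors. *)

Require Import Defs.
From HB Require Import structures.
From mathcomp Require Import all_boot all_order all_fingroup all_algebra.
From mathcomp Require Import reals.
From mathcomp Require Import complex.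
From mathcomp Require Import mpoly.
From mathcomp Require Import ring lra zify.
Import Order.TTheory GRing.Theory Num.Theory ComplexField.Normc.
Local Open Scope ring_scope.

(** * First-order limits at [0+] *)

Definition near0 (R : realType) (Q : R -> Prop) : Prop :=
  exists2 d : R, 0 < d & forall t, 0 < t -> t < d -> Q t.

Lemma near0_imp (R : realType) (Q1 Q2 : R -> Prop) :
  (forall t, 0 < t -> t < 1 -> Q1 t -> Q2 t) -> near0 R Q1 -> near0 R Q2.
Proof.
move=> h [d d0 hd]; exists (Num.min d 1); first by rewrite lt_min d0 ltr01.
by move=> t t0; rewrite lt_min => /andP[td t1]; apply: h => //; apply: hd.
Qed.

Lemma near0_and (R : realType) (Q1 Q2 : R -> Prop) :
  near0 R Q1 -> near0 R Q2 -> near0 R (fun t => Q1 t /\ Q2 t).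
Proof.
move=> [d d0 hd] [e e0 he]; exists (Num.min d e); first by rewrite lt_min d0 e0.
by move=> t t0; rewrite lt_min => /andP[td te]; split; [apply: hd | apply: he].
Qed.

Lemma near0T (R : realType) (Q : R -> Prop) : (forall t, Q t) -> near0 R Q.
Proof. by move=> h; exists 1 => // t _ _; apply: h. Qed.

Lemma near0_ex (R : realType) (Q : R -> Prop) : near0 R Q -> exists2 t, 0 < t & Q t.
Proof.
move=> [d d0 hd]; exists (d / 2); first by rewrite divr_gt0.
by apply: hd; [rewrite divr_gt0 | rewrite ltr_pdivrMr // ltr_pMr // ltr1n].
Qed.

(** A linear error bound rather than mere convergence: each closure rule then produces an explicit
    constant. *)
Definition approx (R : realType) (f : R -> R[i]) (l : R[i]) : Prop :=
  exists C : R, near0 R (fun t => normc (f t - l) <= C * t).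

Lemma normc_real (R : realType) (x : R) : normc x%:C%C = `|x|.
Proof. by rewrite /= expr0n /= addr0 sqrtr_sqr. Qed.

Lemma normc_ge0 (R : realType) (x : R[i]) : 0 <= normc x.
Proof. by case: x => a b; apply: sqrtr_ge0. Qed.

Lemma approx_eq (R : realType) (f g : R -> R[i]) l :
  near0 R (fun t => f t = g t) -> approx R f l -> approx R g l.
Proof.
move=> h [C hC]; exists C; apply: near0_imp (near0_and R _ _ h hC).
by move=> t _ _ [-> ].
Qed.

Lemma approx_cst (R : realType) (l : R[i]) : approx R (fun=> l) l.
Proof.
by exists 0; apply: near0T => t; rewrite subrr mul0r normc0.
Qed.

Lemma approx_id (R : realType) : approx R (fun t => t%:C%C) 0.
Proof.
exists 1; exists 1 => // t t0 _.
by rewrite subr0 normc_real mul1r gtr0_norm.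
Qed.

Lemma approxD (R : realType) (f g : R -> R[i]) a b :
  approx R f a -> approx R g b -> approx R (fun t => f t + g t) (a + b).
Proof.
move=> [C hC] [D hD]; exists (C + D); apply: near0_imp (near0_and R _ _ hC hD).
move=> t _ _ [h1 h2]; rewrite opprD addrACA mulrDl.
by apply: le_trans (le_normcD _ _) _; apply: lerD.
Qed.

Lemma approxM (R : realType) (f g : R -> R[i]) a b :
  approx R f a -> approx R g b -> approx R (fun t => f t * g t) (a * b).
Proof.
move=> [C hC] [D hD]; exists (C * D + C * normc b + normc a * D).
apply: near0_imp (near0_and R _ _ hC hD) => t t0 t1 [h1 h2].
have -> : f t * g t - a * b = (f t - a) * (g t - b) + (f t - a) * b + a * (g t - b).
  by ring.
apply: le_trans (le_normcD _ _) _; rewrite [leRHS]mulrDl lerD //; last first.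
  by rewrite normcM -mulrA ler_wpM2l // normc_ge0.
apply: le_trans (le_normcD _ _) _; rewrite [leRHS]mulrDl lerD //; last first.
  by rewrite normcM mulrAC ler_wpM2r // normc_ge0.
have CD : 0 <= C * t by apply: le_trans h1; apply: normc_ge0.
rewrite normcM; apply: le_trans (_ : (C * t) * (D * t) <= _).
  by apply: ler_pM => //; apply: normc_ge0.
(* The product of the two errors is quadratic in [t]; since [t < 1], the linear bound absorbs it. *)
rewrite [leLHS](_ : _ = C * D * t * t); last by ring.
have D0 : 0 <= D by rewrite -(pmulr_lge0 _ t0); apply: le_trans h2; apply: normc_ge0.
by rewrite ler_piMr ?(ltW t1) // mulrAC mulr_ge0.
Qed.

Lemma approx_sum (R : realType) (I : Type) (r : seq I) (Q : pred I)
    (f : I -> R -> R[i]) (l : I -> R[i]) :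
  (forall i, approx R (f i) (l i)) ->
  approx R (fun t => \sum_(i <- r | Q i) f i t) (\sum_(i <- r | Q i) l i).
Proof.
move=> h; elim: r => [|i r IH].
  by rewrite big_nil; apply: approx_eq (approx_cst R 0); apply: near0T => t; rewrite big_nil.
rewrite big_cons.
have [Qi|Qi] := boolP (Q i); last first.
  by apply: approx_eq IH; apply: near0T => t; rewrite big_cons (negbTE Qi).
by apply: approx_eq (approxD R _ _ _ _ (h i) IH); apply: near0T => t; rewrite big_cons Qi.
Qed.

Lemma approxX (R : realType) (f : R -> R[i]) a k :
  approx R f a -> approx R (fun t => f t ^+ k) (a ^+ k).
Proof.
move=> h; elim: k => [|k IH]; first exact: approx_cst.
rewrite exprS; apply: approx_eq (approxM R _ _ _ _ h IH).
by apply: near0T => t; rewrite exprS.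
Qed.

Lemma approx_prod (R : realType) (I : Type) (r : seq I)
    (f : I -> R -> R[i]) (l : I -> R[i]) :
  (forall i, approx R (f i) (l i)) ->
  approx R (fun t => \prod_(i <- r) f i t) (\prod_(i <- r) l i).
Proof.
move=> h; elim: r => [|i r IH].
  by rewrite big_nil; apply: approx_eq (approx_cst R 1); apply: near0T => t; rewrite big_nil.
rewrite big_cons.
by apply: approx_eq (approxM R _ _ _ _ (h i) IH); apply: near0T => t; rewrite big_cons.
Qed.

Lemma approx_horner (R : realType) (r : {poly R}) :
  approx R (fun t => (r.[t])%:C%C) (r.[0])%:C%C.
Proof.
elim/poly_ind: r => [|r c IH].
  by apply: approx_eq (approx_cst R _); apply: near0T => t; rewrite !horner0.
have e t : (r * 'X + c%:P).[t] = r.[t] * t + c by rewrite hornerMXaddC.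
rewrite e rmorphD rmorphM /=.
apply: approx_eq (approxD R _ _ _ _ (approxM R _ _ _ _ IH (approx_id R)) (approx_cst R c%:C%C)).
by apply: near0T => t; rewrite e rmorphD rmorphM.
Qed.

Lemma approx_eq0 (R : realType) (f : R -> R[i]) l :
  approx R f l -> near0 R (fun t => f t = 0) -> l = 0.
Proof.
move=> [C hC] h0; apply: eq0_normc; apply/eqP/negP => /negP nl.
have lp : 0 < normc l by rewrite lt_def nl normc_ge0.
have : near0 R (fun t => C * t < normc l).
  exists (normc l / (1 + `|C|)); first by rewrite divr_gt0 // ltr_pwDl.
  move=> t t0; rewrite ltr_pdivlMr ?ltr_pwDl // => ht.
  apply: le_lt_trans ht; rewrite mulrC ler_pM2l // (le_trans (ler_norm _)) //.
  by rewrite lerDr.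
move=> /(near0_and R _ _ (near0_and R _ _ hC h0))/near0_ex [t t0 [[h1 ft]]].
by rewrite ft sub0r normcN in h1; rewrite ltNge h1.
Qed.

Lemma approx_neq0 (R : realType) (f : R -> R[i]) l :
  approx R f l -> l != 0 -> near0 R (fun t => normc l / 2 < normc (f t)).
Proof.
move=> [C hC] nl.
have lp : 0 < normc l.
  by rewrite lt_def normc_ge0 andbT; apply: contra nl => /eqP/eq0_normc ->.
have : near0 R (fun t => C * t < normc l / 2).
  exists (normc l / 2 / (1 + `|C|)); first by rewrite !divr_gt0 // ltr_pwDl.
  move=> t t0; rewrite ltr_pdivlMr ?ltr_pwDl // => ht.
  apply: le_lt_trans ht; rewrite mulrC ler_pM2l // (le_trans (ler_norm _)) //.
  by rewrite lerDr.
move=> /(near0_and R _ _ hC); apply: near0_imp => t _ _ [h1 h2].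
have : normc l <= normc (f t) + normc (f t - l).
  by rewrite -(normcN (f t - l)); apply: le_trans (le_normcD _ _); rewrite opprB addrC subrK.
lra.
Qed.

Lemma approxV (R : realType) (f : R -> R[i]) l :
  l != 0 -> approx R f l -> approx R (fun t => (f t)^-1) l^-1.
Proof.
move=> nl h; have [C hC] := h; exists (C / (normc l / 2) / normc l).
have lp : 0 < normc l.
  by rewrite lt_def normc_ge0 andbT; apply: contra nl => /eqP/eq0_normc ->.
apply: near0_imp (near0_and R _ _ hC (approx_neq0 R _ _ h nl)) => t t0 _ [h1 h2].
have fp : 0 < normc (f t) by apply: le_lt_trans h2; rewrite divr_ge0 ?ltW.
have nf : f t != 0 by apply: contraTneq fp => ->; rewrite normc0 ltxx.
have -> : (f t)^-1 - l^-1 = - (f t - l) / f t / l by field; rewrite nl nf.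
rewrite !normcM !normcV normcN [leRHS]mulrAC ler_pM2r ?invr_gt0 // [leRHS]mulrAC.
apply: ler_pM => //; [exact: normc_ge0 | by rewrite invr_ge0 normc_ge0|].
by rewrite lef_pV2 ?posrE ?divr_gt0 // ltW.
Qed.

(** Multiplied by [Num.sqrt a], the error of the root is at most the error of [f], by the difference
    of two squares. *)
Lemma approx_sqrt (R : realType) (f : R -> R) (a : R) :
  0 < a -> approx R (fun t => (f t)%:C%C) a%:C%C ->
  approx R (fun t => (Num.sqrt (f t))%:C%C) (Num.sqrt a)%:C%C.
Proof.
move=> a0 [C hC]; exists (C / Num.sqrt a).
apply: near0_imp hC => t t0 _; rewrite -!rmorphB !normc_real => h.
have s0 : 0 < Num.sqrt a by rewrite sqrtr_gt0.
rewrite mulrAC ler_pdivlMr //; apply: le_trans h.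
(* A negative [f t] has square root 0 by convention; then [a] itself is at most the distance from
   [f t] to [a]. *)
have [f0|f0] := leP 0 (f t); last first.
  rewrite ler0_sqrtr ?ltW // sub0r normrN gtr0_norm // -expr2 sqr_sqrtr ?ltW //.
  by rewrite distrC ger0_norm; lra.
rewrite -{2}(sqr_sqrtr f0) -{3}(sqr_sqrtr (ltW a0)) subr_sqr normrM ler_wpM2l //.
by rewrite ger0_norm ?lerDr ?addr_ge0 ?sqrtr_ge0.
Qed.

(** * Polynomials vanishing along curves *)

(** The lowest digit is the residue modulo [B]; the others follow by division. This separates
    monomials under the Kronecker substitution. *)
Lemma base_expansion_inj (B n : nat) (a b : 'I_n -> nat) :
  (forall i, a i < B)%N -> (forall i, b i < B)%N ->
  (\sum_(i < n) a i * B ^ i = \sum_(i < n) b i * B ^ i)%N -> a =1 b.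
Proof.
elim: n a b => [|n IH] a b ha hb; first by move=> _ [].
have B0 : (0 < B)%N by apply: leq_ltn_trans (ha ord0).
have e (c : 'I_n.+1 -> nat) : (\sum_(i < n.+1) c i * B ^ i =
    (\sum_(i < n) c (lift ord0 i) * B ^ i) * B + c ord0)%N.
  rewrite big_ord_recl muln1 addnC; congr addn; rewrite big_distrl /=.
  by apply: eq_bigr => i _; rewrite /bump /= add1n expnSr mulnA.
rewrite !e => h.
have h0 : a ord0 = b ord0.
  by have := congr1 (modn^~ B) h; rewrite /= !modnMDl !modn_small.
have h1 := congr1 (divn^~ B) h; rewrite /= !divnMDl // !divn_small // !addn0 in h1.
move=> i; have [j ->|->//] := unliftP ord0 i.
exact: (IH (fun j => a (lift ord0 j)) (fun j => b (lift ord0 j))).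
Qed.

Lemma poly_eq0_reals (R : realType) (q : {poly R[i]}) :
  (forall x : R, q.[x%:C%C] = 0) -> q = 0.
Proof.
move=> h; apply/eqP/negP => /negP nq.
(* The integers below [size q] are distinct roots, one more than the degree permits. *)
pose rs : seq R[i] := [seq (k%:R : R)%:C%C | k <- iota 0 (size q)].
have rootrs : all (root q) rs by apply/allP => x /mapP[k _ ->]; apply/rootP/h.
have uniqrs : uniq rs.
  by rewrite map_inj_uniq ?iota_uniq // => x y /complexI/eqP; rewrite eqr_nat => /eqP.
by have := max_poly_roots nq rootrs uniqrs; rewrite size_map size_iota ltnn.
Qed.

(* Kronecker substitution y_i = x ^ (B ^ i). *)
Lemma mpoly_eq0_reals (R : realType) (N : nat) (Q : {mpoly R[i][N]}) :
  (forall y : 'I_N -> R, Q.@[fun k => (y k)%:C%C] = 0) -> Q = 0.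
Proof.
(* [B] exceeds every exponent occurring in [Q], so [e] is injective on the support of [Q]. *)
move=> h; pose B := msize Q.
pose e (m : 'X_{1..N}) := (\sum_(i < N) m i * B ^ i)%N.
pose q : {poly R[i]} := \sum_(m <- msupp Q) Q@_m *: 'X^(e m).
have q0 : q = 0.
  apply: poly_eq0_reals => x; rewrite -[RHS](h (fun i => x ^+ (B ^ i))) mevalE horner_sum.
  apply: eq_bigr => m _; rewrite hornerZ hornerXn; congr (_ * _).
  rewrite /e expr_sum; apply: eq_bigr => i _.
  by rewrite rmorphXn /= -exprM mulnC.
have digit m : m \in msupp Q -> forall i, (m i < B)%N.
  move=> mQ i; apply: leq_ltn_trans (msize_mdeg_lt mQ).
  by rewrite mdegE (bigD1 i) //= leq_addr.
apply/mpolyP => m; rewrite mcoeff0; apply/eqP; apply: contraT.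
rewrite -mcoeff_msupp => mQ.
have := congr1 (coefp (e m)) q0; rewrite /= coef0 coef_sum (big_rem m) //=.
rewrite coefZ coefXn eqxx mulr1 big1_seq ?addr0 => [/eqP|m' /= m'Q].
  by rewrite mcoeff_eq0 mQ.
have : m' \in msupp Q by apply: mem_rem m'Q.
move=> m'Q'; rewrite coefZ coefXn; case: eqP => [ee|]; last by rewrite mulr0.
have : m' = m.
  by apply/mnmP; apply: base_expansion_inj (digit _ m'Q') (digit _ mQ) _.
by move=> E; move: m'Q; rewrite E mem_rem_uniq ?msupp_uniq // inE eqxx.
Qed.

(* The lowest homogeneous part of P at the base point v0 vanishes at every direction L. *)
Lemma mpoly_eq0_of_jets (R : realType) (N : nat) (P : {mpoly R[i][N]}) (v0 : 'I_N -> R[i]) :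
  (forall L : 'I_N -> R, exists2 u : R -> 'I_N -> R[i],
     forall k, approx R (u^~ k) (L k)%:C%C
     & near0 R (fun t => P.@[fun k => v0 k + t%:C%C * u t k] = 0)) ->
  P = 0.
Proof.
move=> h.
(* The base point is moved to the origin, so that order in [t] matches total degree. *)
pose Q := P \mPo [tuple ('X_k + (v0 k)%:MP) | k < N].
have QE v : Q.@[v] = P.@[fun k => v0 k + v k].
  rewrite comp_mpoly_meval; apply: meval_eq => k.
  by rewrite tnth_mktuple mevalD mevalXU mevalC addrC.
suff Q0 : Q = 0.
  apply: mpoly_eq0_reals => y.
  have := QE (fun k => (y k)%:C%C - v0 k); rewrite Q0 meval0 => /esym <-.
  by apply: meval_eq => k; rewrite addrC subrK.
apply/eqP/negP => /negP nQ.
have [m0 m0Q] : exists m, m \in msupp Q.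
  by case E : (msupp Q) => [|m s]; [rewrite -msupp_eq0 E in nQ | exists m; rewrite inE eqxx].
have exd : exists d, has (fun m => mdeg m == d) (msupp Q).
  by exists (mdeg m0); apply/hasP; exists m0.
case: (ex_minnP exd) => d /hasP[m1 m1Q /eqP m1d] mind.
have led m : m \in msupp Q -> (d <= mdeg m)%N.
  by move=> mQ; apply: mind; apply/hasP; exists m.
pose T := \sum_(m <- msupp Q | mdeg m == d) Q@_m *: 'X_[m].
suff T0 : T = 0.
  have := congr1 (mcoeff m1) T0; rewrite mcoeff0 raddf_sum /= (big_rem m1) //= m1d eqxx.
  rewrite mcoeffZ mcoeffX eqxx mulr1 big1_seq ?addr0 => [/eqP|m /andP[_ mr]].
    by rewrite mcoeff_eq0 m1Q.
  rewrite mcoeffZ mcoeffX; case: eqP => [E|]; last by rewrite mulr0.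
  by move: mr; rewrite E mem_rem_uniq ?msupp_uniq // inE eqxx.
apply: mpoly_eq0_reals => L; have [u hu hP] := h L.
(* This is [Q] at [t u] divided by [t ^+ d], written without division; its limit is [T] at [L]. No
   subtraction is truncated, [d] being the least degree in the support. *)
pose f t := \sum_(m <- msupp Q) Q@_m * (t%:C%C ^+ (mdeg m - d) * \prod_k u t k ^+ m k).
apply: (@approx_eq0 R f); last first.
  apply: near0_imp hP => t t0 _; rewrite -QE mevalE => hQ.
  have nt : t%:C%C ^+ d != 0 :> R[i].
    by rewrite expf_neq0 // (inj_eq (@complexI _) t 0) gt_eqF.
  apply: (mulfI nt); rewrite mulr0 -[RHS]hQ big_distrr /=.
  apply: eq_big_seq => m mQ; rewrite mulrCA; congr (_ * _).
  rewrite mulrA -exprD subnKC ?led //.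
  rewrite mdegE -prodrXr -big_split /=; apply: eq_bigr => k _.
  by rewrite exprMn.
(* The factor [0 ^+ (mdeg m - d)] is 1 in degree [d] and 0 in higher degrees, which selects the
   lowest part. *)
have -> : T.@[fun k => (L k)%:C%C] = \sum_(m <- msupp Q)
    Q@_m * (0 ^+ (mdeg m - d) * \prod_k (L k)%:C%C ^+ m k).
  rewrite raddf_sum /= big_mkcond; apply: eq_big_seq => m mQ.
  have := led m mQ; rewrite leq_eqVlt eq_sym => /predU1P[->|dm].
    by rewrite eqxx subnn expr0 mul1r mevalZ mevalX.
  by rewrite gtn_eqF // expr0n subn_eq0 leqNgt dm mul0r mulr0.
apply: approx_sum => m; apply: approxM; first exact: approx_cst.
apply: approxM; first exact/approxX/approx_id.
by apply: approx_prod => k; apply: approxX.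
Qed.

(** * Determinants near the Gram matrix of the regular simplex *)

(** The remainder is exact and the ring arbitrary, so that [t] can later be the indeterminate
    ['X]. *)
Lemma prod_1D (K : comNzRingType) (I : Type) (s : seq I) (b : I -> K) (t : K) :
  exists r, \prod_(i <- s) (1 + t * b i) = 1 + t * \sum_(i <- s) b i + t ^+ 2 * r.
Proof.
elim: s => [|i s [r IH]]; first by exists 0; rewrite !big_nil; ring.
exists (r + b i * \sum_(i <- s) b i + t * b i * r).
by rewrite !big_cons IH; ring.
Qed.

(** In the Leibniz expansion a non-identity permutation moves at least two indices, so its term has
    two off-diagonal factors and is divisible by [t ^+ 2]. Only the diagonal product contributes to
    first order. *)
Lemma det_1D (K : comNzRingType) (m : nat) (B : 'M[K]_m) (t : K) :
  exists r, \det (1%:M + t *: B) = 1 + t * \tr B + t ^+ 2 * r.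
Proof.
have [r1 e1] := prod_1D K _ (index_enum 'I_m) (fun i => B i i) t.
have [r2 e2] : exists r2, \sum_(s : 'S_m | s != 1%g)
    (-1) ^+ s * \prod_i (1%:M + t *: B) i (s i) = t ^+ 2 * r2.
  apply: (big_ind (fun x => exists r, x = t ^+ 2 * r)).
  - by exists 0; rewrite mulr0.
  - by move=> x y [a ->] [b ->]; exists (a + b); rewrite mulrDr.
  move=> s ns.
  have [i si] : exists i, s i != i.
    apply/existsP; apply: contraR ns; rewrite negb_exists => /forallP h.
    by apply/eqP/permP => i; rewrite perm1; apply/eqP; have := h i; rewrite negbK.
  have ssi : s (s i) != s i by rewrite (inj_eq perm_inj).
  exists ((-1) ^+ s * (B i (s i) * (B (s i) (s (s i)) *
    \prod_(k | (k != i) && (k != s i)) (1%:M + t *: B) k (s k)))).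
  rewrite (bigD1 i) //= (bigD1 (s i)) //=.
  rewrite !mxE [i == _]eq_sym (negbTE si) [s i == _]eq_sym (negbTE ssi) /= !add0r.
  move: (\prod_(_ | _) _) (B i _) (B (s i) _) ((-1) ^+ _) => x y z w.
  by ring.
exists (r1 + r2); rewrite /determinant (bigD1 1%g) //= e2 odd_perm1 mul1r.
under eq_bigr do rewrite perm1 !mxE eqxx /=.
by rewrite e1 -!addrA -mulrDr.
Qed.

(** Gram matrix of the edge vectors at a vertex of a regular simplex with squared edge length 2. *)
Definition regular_gram (R : realType) (m : nat) : 'M[R]_m := \matrix_(i, j) ((i == j)%:R + 1).

Lemma sum_diracl (R : nzRingType) (m : nat) (i : 'I_m) (F : 'I_m -> R) :
  \sum_j (i == j)%:R * F j = F i.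
Proof.
rewrite (bigD1 i) //= eqxx mul1r big1 ?addr0 // => j; rewrite eq_sym => /negbTE ->.
by rewrite mul0r.
Qed.

(** With [J] the all-ones matrix, [1 + b J] is symmetric with square [1 + (m b ^ 2 + 2 b) J], so [b]
    is chosen to solve [m b ^ 2 + 2 b = 1]. *)
Lemma regular_gram_factor (R : realType) (m : nat) :
  exists N : 'M[R]_m, N *m N^T = regular_gram R m.
Proof.
pose s : R := Num.sqrt (m%:R + 1).
have s2 : s ^+ 2 = m%:R + 1 by rewrite sqr_sqrtr // addr_ge0.
have s0 : 0 <= s by apply: sqrtr_ge0.
pose b := (s + 1)^-1.
have bE : m%:R * b ^+ 2 + 2 * b = 1.
  have -> : m%:R = s ^+ 2 - 1 by rewrite s2 addrK.
  by rewrite /b; field; lra.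
exists (\matrix_(i, j) ((i == j)%:R + b)); apply/matrixP => i j; rewrite !mxE.
under eq_bigr do rewrite !mxE mulrDl mulrDr.
rewrite !big_split /= sum_diracl -!big_distrr /= big_split /= sumr_const card_ord.
have d k : \sum_j (k == j :> 'I_m)%:R = 1 :> R.
  by rewrite -[RHS](sum_diracl _ _ k (fun=> 1)); apply: eq_bigr => l _; rewrite mulr1.
rewrite -big_distrl /= !d [j == i]eq_sym -mulr_natl -addrA; congr (_ + _).
by rewrite -[RHS]bE; ring.
Qed.

(** Sherman-Morrison inverse of the identity plus a rank-one matrix. *)
Lemma regular_gram_inv (R : realType) (m : nat) :
  regular_gram R m *m (1%:M - (m%:R + 1)^-1 *: const_mx 1) = 1%:M.
Proof.
have nz : m%:R + 1 != 0 :> R by rewrite gt_eqF // ltr_wpDl.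
apply/matrixP => i j; rewrite !mxE.
under eq_bigr do rewrite !mxE mulrDl.
rewrite big_split /= sum_diracl -big_distrr /= sumrB sumr_const card_ord mulr1 mul1r.
have -> : \sum_k (k == j :> 'I_m)%:R = 1 :> R.
  rewrite -[RHS](sum_diracl _ _ j (fun=> 1)); apply: eq_bigr => l _.
  by rewrite mulr1 eq_sym.
rewrite -mulr_natr; field.
by rewrite ?nz.
Qed.

(** The inverse excludes 0, and the factorization makes the determinant a square. *)
Lemma det_regular_gram_gt0 (R : realType) (m : nat) : 0 < \det (regular_gram R m).
Proof.
have := congr1 determinant (regular_gram_inv R m); rewrite det_mulmx det1 => h.
have nz : \det (regular_gram R m) != 0.
  by apply: contra_eq_neq h => ->; rewrite mul0r eq_sym oner_neq0.
have [N e] := regular_gram_factor R m.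
by rewrite lt_def nz /= -e det_mulmx det_tr -expr2 sqr_ge0.
Qed.

(** Jacobi's formula: with the regular Gram matrix factored out and [H] its inverse, the linear
    coefficient is the trace of [H *m G]. The contribution of [E] is of second order and joins
    [r]. *)
Lemma det_gram_jet (R : realType) (m : nat) (G : 'M[R]_m) (E : 'M[{poly R}]_m) :
  exists r, \det (map_mx polyC (regular_gram R m) + 'X *: map_mx polyC G + 'X^2 *: E) =
    (\det (regular_gram R m))%:P *
    (1 + 'X * (\tr G - (m%:R + 1)^-1 * \sum_i \sum_j G i j)%:P + 'X^2 * r).
Proof.
pose H : 'M[R]_m := 1%:M - (m%:R + 1)^-1 *: const_mx 1.
pose HE := map_mx polyC H *m (map_mx polyC G + 'X *: E).
have -> : map_mx polyC (regular_gram R m) + 'X *: map_mx polyC G + 'X^2 *: E =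
    map_mx polyC (regular_gram R m) *m (1%:M + 'X *: HE).
  rewrite mulmxDr mulmx1 -scalemxAr /HE mulmxA -map_mxM regular_gram_inv map_mx1 mul1mx.
  by rewrite scalerDr scalerA addrA.
rewrite det_mulmx det_map_mx; have [r ->] := det_1D _ _ HE 'X.
exists (\tr (map_mx polyC H *m E) + r).
have -> : \tr HE = (\tr (H *m G))%:P + 'X * \tr (map_mx polyC H *m E).
  by rewrite /HE mulmxDr mxtraceD -map_mxM trace_map_mx -scalemxAr mxtraceZ.
have -> : \tr (H *m G) = \tr G - (m%:R + 1)^-1 * \sum_i \sum_j G i j.
  rewrite mulmxBl mul1mx -scalemxAl raddfB /= mxtraceZ; congr (_ - _ * _).
  rewrite exchange_big /=; apply: eq_bigr => i _; rewrite !mxE.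
  by apply: eq_bigr => k _; rewrite mxE mul1r.
ring.
Qed.

(** * Edge variations and face volumes *)

(** A face is the complement of a pair of vertices. Off the diagonal, [h] is sought as a combination
    of the data [z], its row sums and its total; [3 <= n] keeps the denominators [N - 1] and [N - 2]
    nonzero. *)
Lemma face_sum_surj (R : realType) (n : nat) (y : {set 'I_n.+1} -> R) : (3 <= n)%N ->
  exists h : 'I_n.+1 -> 'I_n.+1 -> R,
    [/\ forall i j, h i j = h j i, forall i, h i i = 0
      & forall S : {set 'I_n.+1}, #|S| = n.-1 ->
        \sum_(i in S) \sum_(j in S) h i j = y S].
Proof.
move=> hn.
(* The data are halved because the double sum over a face counts every edge twice. *)
pose z a b : R := if a == b then 0 else y (~: [set a; b]) / 2.
have zC a b : z a b = z b a by rewrite /z eq_sym setUC.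
have zz a : z a a = 0 by rewrite /z eqxx.
pose Z a := \sum_b z a b.
pose T := \sum_a Z a.
pose N : R := n%:R.
have N3 : 3 <= N by rewrite ler_nat.
(* With z vanishing on the diagonal and S = ~: [set a; b], half of the double sum of h over S is
   (sum of h over all edges) - d a - d b + h a b, d being the row sums of h; la and mu make this
   equal to z a b. *)
pose la : R := - (N - 2)^-1.
pose mu : R := ((N - 1) * (N - 2))^-1.
pose w a b := z a b + la * (Z a + Z b) + mu * T.
pose h a b := if a == b then 0 else w a b.
have hC i j : h i j = h j i by rewrite /h /w eq_sym zC [Z i + _]addrC.
have hh i : h i i = 0 by rewrite /h eqxx.
have sumc (c : R) : \sum_(b < n.+1) c = c * (N + 1).
  by rewrite sumr_const card_ord -mulr_natr -natr1.
have rowsum a : \sum_b h a b = Z a * (1 + la * (N - 1)) + T * (la + N * mu).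
  (* Unlike [h], [w] need not vanish on the diagonal, so its diagonal term is removed. *)
  have -> : \sum_b h a b = \sum_b w a b - w a a.
    rewrite (bigD1 a) //= hh add0r [in RHS](bigD1 a) //= [w a a + _]addrC addrK.
    by apply: eq_bigr => b; rewrite /h eq_sym => /negbTE ->.
  rewrite /w !big_split /= -big_distrr /= big_split /= !sumc -/(Z a) -/T zz.
  by ring.
have total : \sum_a \sum_b h a b = T * (1 + la * (N - 1) + (N + 1) * (la + N * mu)).
  under eq_bigr do rewrite rowsum.
  by rewrite big_split /= -big_distrl /= sumc -/T; ring.
exists h; split=> // S cS.
have : #|~: S| == 2%N.
  by rewrite cardsCs setCK card_ord cS; apply/eqP; lia.
move=> /cards2P [a [b [ab Sab]]].
have sumS (F : 'I_n.+1 -> R) : \sum_(i in S) F i = \sum_i F i - F a - F b.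
  have -> : \sum_i F i = F a + (F b + \sum_(i in S) F i).
    rewrite (bigD1 a) //= (bigD1 b) 1?eq_sym //=; do 2!congr (_ + _).
    by apply: eq_bigl => i; rewrite -[S in RHS]setCK Sab !inE negb_or.
  by ring.
rewrite sumS; under eq_bigr do rewrite sumS.
rewrite !sumS !sumrB total [\sum_i h i a](eq_bigr (h a)) // [\sum_i h i b](eq_bigr (h b)) //.
rewrite !rowsum !hh [h b a]hC /h (negbTE ab) /w /z (negbTE ab) -Sab setCK /la /mu.
by field; lra.
Qed.

(** * Scalar products and the realization of edge variations *)

Definition dot (R : realType) (n : nat) (u v : 'rV[R]_n) : R := (u *m v^T) 0 0.

Lemma dotC (R : realType) (n : nat) (u v : 'rV[R]_n) : dot R n u v = dot R n v u.
Proof. by rewrite /dot !mxE; apply: eq_bigr => k _; rewrite !mxE mulrC. Qed.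

Lemma dotDl (R : realType) (n : nat) (u v w : 'rV[R]_n) :
  dot R n (u + v) w = dot R n u w + dot R n v w.
Proof. by rewrite /dot mulmxDl mxE. Qed.

Lemma dotNl (R : realType) (n : nat) (u w : 'rV[R]_n) : dot R n (- u) w = - dot R n u w.
Proof. by rewrite /dot mulNmx mxE. Qed.

Lemma dotZl (R : realType) (n : nat) (t : R) (u w : 'rV[R]_n) :
  dot R n (t *: u) w = t * dot R n u w.
Proof. by rewrite /dot -scalemxAl mxE. Qed.

Lemma dotDr (R : realType) (n : nat) (u v w : 'rV[R]_n) :
  dot R n w (u + v) = dot R n w u + dot R n w v.
Proof. by rewrite dotC dotDl !(dotC _ _ w). Qed.

Lemma dotNr (R : realType) (n : nat) (u w : 'rV[R]_n) : dot R n w (- u) = - dot R n w u.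
Proof. by rewrite dotC dotNl (dotC _ _ w). Qed.

Lemma dotZr (R : realType) (n : nat) (t : R) (u w : 'rV[R]_n) :
  dot R n w (t *: u) = t * dot R n w u.
Proof. by rewrite dotC dotZl (dotC _ _ w). Qed.

Lemma dot_row (R : realType) (n m k : nat) (A : 'M[R]_(m, n)) (B : 'M[R]_(k, n)) i j :
  dot R n (row i A) (row j B) = (A *m B^T) i j.
Proof. by rewrite /dot !mxE; apply: eq_bigr => l _; rewrite !mxE. Qed.

(** The vertices are the origin and the rows of a factor [N] of the regular Gram matrix. As [N] is
    invertible, the products of positions with velocities [q] can be prescribed freely; [2 * dot] is
    the resulting rate of change of a squared edge length. *)
Lemma regular_simplex (R : realType) (n : nat) :
  exists p : 'I_n.+1 -> 'rV[R]_n,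
    [/\ nondegenerate_simplex p,
        forall i j, dot R n (p i - p j) (p i - p j) = 2 * (i != j)%:R
      & forall h : 'I_n.+1 -> 'I_n.+1 -> R,
        (forall i j, h i j = h j i) -> (forall i, h i i = 0) ->
        exists q : 'I_n.+1 -> 'rV[R]_n,
          forall i j, 2 * dot R n (p i - p j) (q i - q j) = h i j].
Proof.
have [N NN] := regular_gram_factor R n.
have detN : \det N != 0.
  have := det_regular_gram_gt0 R n; rewrite -NN det_mulmx det_tr.
  by apply: contraTneq => ->; rewrite mul0r ltxx.
have Nu : N \in unitmx by rewrite unitmxE unitfE.
pose pt (A : 'M[R]_n) v := if unlift ord0 v is Some i then row i A else 0.
have pt0 A : pt A ord0 = 0 by rewrite /pt unlift_none.
have ptS A i : pt A (lift ord0 i) = row i A by rewrite /pt liftK.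
exists (pt N); split.
- rewrite /nondegenerate_simplex (_ : \matrix_(i < n) _ = N) //.
  by apply/row_matrixP => i; rewrite rowK ptS pt0 subr0.
- move=> i j; have [i' ->|->] := unliftP ord0 i; have [j' ->|->] := unliftP ord0 j;
    rewrite ?pt0 ?ptS ?subrr ?sub0r ?subr0 ?dotDl ?dotDr ?dotNl ?dotNr ?dot_row ?NN ?mxE ?eqxx.
  + by rewrite (inj_eq lift_inj) [j' == i']eq_sym; case: eqP => _ /=; ring.
  + by rewrite eq_sym neq_lift /=; ring.
  + by rewrite neq_lift /=; ring.
  + by rewrite /dot mul0mx mxE /= ?mulr0.
move=> h hC hh.
(* Taken symmetric, the position-velocity products follow from [h] by polarization; 4 is the 2 of
   polarization times the 2 in the derivative of a squared length. *)
pose g : 'M[R]_n :=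
  \matrix_(i, j)
    ((h (lift ord0 i) ord0 + h (lift ord0 j) ord0 - h (lift ord0 i) (lift ord0 j)) / 4).
have gT : g^T = g by apply/matrixP => i j; rewrite !mxE [h (lift ord0 j) (lift ord0 i)]hC; ring.
pose Q := g *m (invmx N)^T.
have QN : Q *m N^T = g by rewrite /Q -mulmxA -trmx_mul mulmxV // trmx1 mulmx1.
have NQ : N *m Q^T = g by rewrite -[LHS]trmxK trmx_mul trmxK QN.
exists (pt Q) => i j; have [i' ->|->] := unliftP ord0 i; have [j' ->|->] := unliftP ord0 j;
  rewrite ?pt0 ?ptS ?subrr ?sub0r ?subr0 ?dotDl ?dotDr ?dotNl ?dotNr ?dot_row ?NQ ?mxE ?hh.
+ by rewrite [h (lift ord0 j') (lift ord0 i')]hC; field.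
+ by field.
+ by rewrite [h ord0 _]hC; field.
+ by rewrite /dot mul0mx mxE /= ?mulr0.
Qed.

(** * Face volumes along a line of simplices *)

Lemma simplex_volumeE (R : realType) (n m : nat) (q0 : 'rV[R]_n) (qs : seq 'rV[R]_n) :
  size qs = m ->
  simplex_volume q0 qs =
  Num.sqrt (\det (\matrix_(i < m, j < m) dot R n (nth 0 qs i - q0) (nth 0 qs j - q0))) / m`!%:R.
Proof.
move=> <-; rewrite /simplex_volume; congr (Num.sqrt (\det _) / _).
apply/matrixP => i j; rewrite mxE [RHS]mxE /dot mxE.
by apply: eq_bigr => k _; rewrite !mxE.
Qed.

(** For [a = b] and [c = d] this is the law of cosines. With [b] and [d] the velocities of [a] and
    [c], it expresses the first-order change of a Gram entry through edge variations. *)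
Lemma dot_polar (R : realType) (n : nat) (a b c d : 'rV[R]_n) :
  dot R n a d + dot R n b c = dot R n a b + dot R n c d - dot R n (a - c) (b - d).
Proof. by rewrite !(dotDl, dotDr, dotNl, dotNr) [dot R n b c]dotC; ring. Qed.

Lemma dot_affine (R : realType) (n : nat) (t : R) (a b c d : 'rV[R]_n) :
  dot R n (a + t *: b) (c + t *: d) =
  dot R n a c + t * (dot R n a d + dot R n b c) + t ^+ 2 * dot R n b d.
Proof. by rewrite !(dotDl, dotDr, dotZl, dotZr); ring. Qed.

(** The Gram matrix of the moving face, based at its first vertex [v], is the regular one plus
    [t G + t ^ 2 E]. In the linear coefficient from [det_gram_jet], the edges at [v] and the other
    edges get equal weight, so the choice of [v] disappears. *)
Lemma face_volume_jet (R : realType) (n : nat) (p q : 'I_n.+1 -> 'rV[R]_n)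
    (h : 'I_n.+1 -> 'I_n.+1 -> R) (S : {set 'I_n.+1}) (m : nat) :
  (forall i j, dot R n (p i - p j) (p i - p j) = 2 * (i != j)%:R) ->
  (forall i j, 2 * dot R n (p i - p j) (q i - q j) = h i j) ->
  #|S| = m.+1 ->
  exists r : {poly R}, forall t, face_volume (fun v => p v + t *: q v) S =
    Num.sqrt (\det (regular_gram R m) *
      (1 + t * ((2 * (m%:R + 1))^-1 * \sum_(i in S) \sum_(j in S) h i j) + t ^+ 2 * r.[t]))
    / m`!%:R.
Proof.
move=> hp hq; rewrite cardE.
have hC i j : h i j = h j i.
  by rewrite -!hq -[p i - _]opprB -[q i - _]opprB dotNl dotNr opprK.
have hh i : h i i = 0 by rewrite -hq !subrr /dot mul0mx mxE mulr0.
have -> : \sum_(i in S) \sum_(j in S) h i j =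
    \sum_(i <- enum S) \sum_(j <- enum S) h i j.
  by rewrite big_enum; apply: eq_bigr => i _; rewrite big_enum.
rewrite /face_volume.
case: (enum S) (enum_uniq S) => // v ws /= /andP[vws uws] [sws].
pose w (i : 'I_m) := nth v ws i.
have wv i : w i != v.
  by apply: contraNneq vws => <-; rewrite mem_nth // sws.
have wI i j : (w i == w j) = (i == j) by rewrite nth_uniq ?sws.
pose G : 'M[R]_m := \matrix_(i, j) ((h (w i) v + h (w j) v - h (w i) (w j)) / 2).
pose E : 'M[R]_m := \matrix_(i, j) dot R n (q (w i) - q v) (q (w j) - q v).
have [r hr] := det_gram_jet R m G (map_mx polyC E).
exists r => t.
rewrite (simplex_volumeE R n m); last by rewrite size_map.
congr (Num.sqrt _ / _).
(* The Gram matrix is one polynomial matrix evaluated at [t], so a single [r] serves all [t]. *)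
have -> : (\matrix_(i < m, j < m) dot R n
    (nth 0 [seq p i + t *: q i | i <- ws] i - (p v + t *: q v))
    (nth 0 [seq p i + t *: q i | i <- ws] j - (p v + t *: q v))) =
    map_mx (horner_eval t)
      (map_mx polyC (regular_gram R m) + 'X *: map_mx polyC G + 'X^2 *: map_mx polyC E).
  apply/matrixP => i j; rewrite !mxE /horner_eval !(hornerD, hornerM, hornerXn, hornerX, hornerC).
  rewrite !(nth_map v) ?sws // -/(w i) -/(w j).
  have e k : p (w k) + t *: q (w k) - (p v + t *: q v) =
    (p (w k) - p v) + t *: (q (w k) - q v).
    by rewrite opprD addrACA scalerBr.
  have subp k l : p k - p l = (p k - p v) - (p l - p v) by rewrite opprB addrA subrK.
  have subq k l : q k - q l = (q k - q v) - (q l - q v) by rewrite opprB addrA subrK.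
  have gp : dot R n (p (w i) - p v) (p (w j) - p v) = (i == j)%:R + 1.
    have := dot_polar R n (p (w i) - p v) (p (w i) - p v) (p (w j) - p v) (p (w j) - p v).
    rewrite -subp !hp !wv wI; case: eqP => _ /=; lra.
  rewrite !e dot_affine gp dot_polar -subp -subq -!hq.
  by field.
rewrite det_map_mx hr /= /horner_eval !(hornerD, hornerM, hornerXn, hornerX, hornerC).
congr (_ * (_ + _ * _ + _)).
have sumw (F : 'I_n.+1 -> R) : \sum_(i <- v :: ws) F i = F v + \sum_i F (w i).
  by rewrite big_cons (big_nth v) big_mkord sws.
rewrite !sumw; under [X in _ = _ * (_ + X)]eq_bigr do rewrite sumw hC.
rewrite hh add0r big_split /=.
have trG : \tr G = \sum_i h v (w i).
  apply: eq_bigr => i _; rewrite mxE hh subr0 hC.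
  by field.
have sumG : \sum_i \sum_j G i j =
    m%:R * (\sum_i h v (w i)) - (\sum_i \sum_j h (w i) (w j)) / 2.
  under eq_bigr => i _.
    under eq_bigr do rewrite mxE [h _ v]hC [h (w _) v]hC.
    rewrite -big_distrl /= !big_split /= sumrN sumr_const card_ord; over.
  rewrite -big_distrl /= !big_split /= sumrN sumr_const card_ord sumrMnl -!(mulr_natl (\sum_i _)).
  by field.
rewrite trG sumG; have m0 : m%:R + 1 != 0 :> R by rewrite gt_eqF // ltr_wpDl.
by field.
Qed.

(** The root of [f] has a positive limit, while [Num.sqrt] is 0 on nonpositive arguments. *)
Lemma near0_sqrt_pos (R : realType) (f : R -> R) (a : R) :
  0 < a -> approx R (fun t => (f t)%:C%C) a%:C%C -> near0 R (fun t => 0 < f t).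
Proof.
move=> a0 /(approx_sqrt R f a a0) h.
have nz : (Num.sqrt a)%:C%C != 0 :> R[i].
  by rewrite (inj_eq (@complexI _) _ 0) gt_eqF // sqrtr_gt0.
apply: near0_imp (approx_neq0 R _ _ h nz) => t _ _ ht.
rewrite -sqrtr_gt0 lt_def sqrtr_ge0 andbT.
apply: contraTneq ht => ->; rewrite -leNgt normc0.
by rewrite divr_ge0 // normc_ge0.
Qed.

(* v := sqrt (D (1 + t a + t^2 r)) satisfies (v - sqrt D) / t = D (a + t r) / (v + sqrt D). *)
Lemma approx_sqrt_slope (R : realType) (D a : R) (r : {poly R}) : 0 < D ->
  approx R (fun t => ((Num.sqrt (D * (1 + t * a + t ^+ 2 * r.[t])) - Num.sqrt D) / t)%:C%C)
    (Num.sqrt D * a / 2)%:C%C.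
Proof.
move=> D0; pose g := D%:P * (1 + 'X * a%:P + 'X^2 * r).
(* [k] is the quotient of [g - D%:P] by ['X]. *)
pose k := D%:P * (a%:P + 'X * r).
have gE t : g.[t] = D * (1 + t * a + t ^+ 2 * r.[t]).
  by rewrite !(hornerD, hornerM, hornerXn, hornerX, hornerC).
have kE t : k.[t] = D * (a + t * r.[t]).
  by rewrite !(hornerD, hornerM, hornerXn, hornerX, hornerC).
have hg : approx R (fun t => (g.[t])%:C%C) D%:C%C.
  by have := approx_horner R g; rewrite gE !mul0r expr0n mul0r !addr0 mulr1.
have hk : approx R (fun t => (k.[t])%:C%C) (D * a)%:C%C.
  by have := approx_horner R k; rewrite kE !mul0r addr0.
have s0 : 0 < Num.sqrt D by rewrite sqrtr_gt0.
have hv := approx_sqrt R _ _ D0 hg.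
have nz : (Num.sqrt D)%:C%C + (Num.sqrt D)%:C%C != 0 :> R[i].
  by rewrite -rmorphD (inj_eq (@complexI _) _ 0) gt_eqF // addr_gt0.
have := approxM R _ _ _ _ hk
  (approxV R _ _ nz (approxD R _ _ _ _ hv (approx_cst R (Num.sqrt D)%:C%C))).
have -> : (D * a)%:C%C * ((Num.sqrt D)%:C%C + (Num.sqrt D)%:C%C)^-1 =
    (Num.sqrt D * a / 2)%:C%C :> R[i].
  rewrite -rmorphD -fmorphV -rmorphM /= -{1}(sqr_sqrtr (ltW D0)); congr (_%:C%C).
  by field; rewrite gt_eqF // addr_gt0.
apply: approx_eq; apply: near0_imp (near0_sqrt_pos R _ _ D0 hg) => t t0 _ gt0.
rewrite -rmorphD -fmorphV -rmorphM /=; congr (_%:C%C).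
have v0 : 0 <= Num.sqrt g.[t] by apply: sqrtr_ge0.
have v2 := sqr_sqrtr (ltW gt0); have D2 := sqr_sqrtr (ltW D0).
rewrite -gE; apply: (@mulIf _ (t * (Num.sqrt g.[t] + Num.sqrt D))).
  by rewrite mulf_neq0 // gt_eqF // ltr_wpDl.
transitivity (t * k.[t]); first by field; rewrite gt_eqF // ltr_wpDl.
transitivity (Num.sqrt g.[t] ^+ 2 - Num.sqrt D ^+ 2).
  by rewrite v2 D2 gE kE; ring.
by field; rewrite gt_eqF.
Qed.

(** Along the line the determinant is a polynomial in [t] that is nonzero at 0. *)
Lemma near0_nondegenerate (R : realType) (n : nat) (p q : 'I_n.+1 -> 'rV[R]_n) :
  nondegenerate_simplex p -> near0 R (fun t => nondegenerate_simplex (fun v => p v + t *: q v)).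
Proof.
pose M (p : 'I_n.+1 -> 'rV[R]_n) := \matrix_(i < n) (p (lift ord0 i) - p ord0).
rewrite /nondegenerate_simplex -/(M p) => np.
pose d := \det (map_mx polyC (M p) + 'X *: map_mx polyC (M q)).
have dE t : d.[t] = \det (M (fun v => p v + t *: q v)).
  rewrite -[LHS]/(horner_eval t d) -det_map_mx; congr (\det _).
  apply/matrixP => i j; rewrite !mxE /= /horner_eval !(hornerD, hornerM, hornerX, hornerC).
  by ring.
have d0 : d.[0] = \det (M p).
  by rewrite dE; congr (\det _); apply/matrixP => i j; rewrite !mxE !mul0r !addr0.
have nd : d.[0]%:C%C != 0 :> R[i] by rewrite (inj_eq (@complexI _) _ 0) d0.
apply: near0_imp (approx_neq0 R _ _ (approx_horner R d) nd) => t _ _.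
rewrite -/(M _) -dE => h; apply: contraTneq h => ->.
by rewrite normc0 -leNgt divr_ge0 // normc_ge0.
Qed.

(** * Algebraic independence of the face volumes *)

Theorem theorem1 (R : realType) (n : nat) (hn : (3 <= n)%N)
    (P : {mpoly R[i][#|{: face_index n}|]}) :
  (forall p : 'I_n.+1 -> 'rV[R]_n, nondegenerate_simplex p -> P.@[face_volumes p] = 0) ->
  P = 0.
Proof.
move=> hP; have [p [ndp hp dir]] := regular_simplex R n.
pose m := n.-2; pose D := \det (regular_gram R m).
have D0 : 0 < D by apply: det_regular_gram_gt0.
have s0 : 0 < Num.sqrt D by rewrite sqrtr_gt0.
have m0 : 0 < m%:R + 1 :> R by rewrite ltr_wpDl.
have f0 : 0 < m`!%:R :> R by rewrite ltr0n fact_gt0.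
(* Codimension-two faces of the regular simplex are congruent, so the base point has equal
   coordinates. *)
pose v0 : R := Num.sqrt D / m`!%:R.
apply: (@mpoly_eq0_of_jets R _ P (fun=> v0%:C%C)) => L.
(* Rate of change of a volume per unit of the double sum of [h] over its face; one [/ 2] comes from
   differentiating the square root. *)
pose kap : R := Num.sqrt D * (2 * (m%:R + 1))^-1 / 2 / m`!%:R.
have kap0 : 0 < kap by rewrite !divr_gt0 // mulr_gt0 // invr_gt0 mulr_gt0.
(* The prescribed velocities [L], rescaled by [kap] and extended by 0 to sets of the wrong
   cardinality. *)
pose y (S : {set 'I_n.+1}) : R :=
  (if insub S is Some s then L (enum_rank (s : face_index n)) else 0) / kap.
have [h [hC hh hS]] := face_sum_surj R n y hn.
have [q hq] := dir h hC hh.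
pose V t (k : 'I_#|{: face_index n}|) :=
  face_volume (fun v => p v + t *: q v) (val (enum_val k : face_index n)).
(* With the difference quotient as [u], [v0 + t u] is exactly the volume vector for [t > 0], so the
   hypothesis on [P] applies wherever the moved simplex is nondegenerate. *)
exists (fun t k => ((V t k - v0) / t)%:C%C).
  move=> k; pose s : face_index n := enum_val k.
  have cs : #|val s| = m.+1 by rewrite (eqP (valP s)) /m; lia.
  have [r hr] := face_volume_jet R n p q h (val s) m hp hq cs.
  set a := _ * \sum_(i in _) _ in hr.
  have -> : L k = Num.sqrt D * a / 2 * m`!%:R^-1.
    rewrite /a hS; last by rewrite cs /m; lia.
    rewrite /y valK enum_valK /kap.
    by field; rewrite !gt_eqF.
  rewrite rmorphM.
  apply: approx_eq (approxM R _ _ _ _ (approx_sqrt_slope R D a r D0) (approx_cst R _)).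
  apply: near0_imp (near0T R (fun=> True) (fun=> I)) => t t0 _ _.
  rewrite -rmorphM /V -/s hr -/D /v0; congr (_%:C%C).
  by field; rewrite !gt_eqF.
apply: near0_imp (near0_nondegenerate R n p q ndp) => t t0 _ nd.
rewrite -[RHS](hP _ nd); apply: meval_eq => k.
rewrite -rmorphM -rmorphD /face_volumes -/(V t k); congr (_%:C%C).
by rewrite mulrC divfK ?gt_eqF // addrC subrK.
Qed.
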